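(* On $M=\mathbb R^4$ with coordinates $(x,y,z,w)$ let $g=e^z$, let $$\eta=\frac{g}{\sqrt2}\Big(dw-\frac y2dx+\frac x2dy\Big),\qquad\mathcal D=\ker\eta,$$ and let $\mathbf g$ be the metric on $\mathcal D$ for which $$X=\frac1{\sqrt g}\Big(\partial_x+\frac12y\,\partial_w\Big),\qquad Y=\frac1{\sqrt g}\Big(\partial_y-\frac12x\,\partial_w\Big),\qquad Z=\frac1{\sqrt g}\partial_z$$ is a global orthonormal frame. Let $\mathcal P=\frac{g^{5/2}}{\sqrt2}\,dx\wedge dy\wedge dz\wedge dw$, which is Popp's volume of this sub-Riemannian structure. Then $L^{\mathbf c}\neq\Delta_{\mathcal P}$ for any choice of the complement $\mathbf c$.
   Context: A complement $\mathbf c$ is a smooth sub-bundle of $TM$ with $TM=\mathcal D\oplus\mathbf c$ (here of rank $1$). Let $n=4$, $k=3$. Macroscopic Laplacian: $\Delta_\omega=\mathrm{div}_\omega\circ\mathrm{grad}$, where $\mathrm{grad}(f)\in\Gamma(\mathcal D)$ is defined by $\mathbf g(\mathrm{grad}(f),V)=df(V)$ for $V\in\Gamma(\mathcal D)$, and $\mathrm{div}_\omega(V)\,\omega=\mathcal L_V\omega$. Microscopic Laplacian: let $H(\lambda)=\frac12\sum_{i=1}^k\langle\lambda,X_i\rangle^2$ on $T^*M$ ($X_1,\dots,X_k$ an orthonormal frame of $\mathcal D$), $C_q=\{\lambda\in T^*_qM:2H(\lambda)=1\}$, and $\exp_q(t,\lambda)$ the projection to $M$ of the integral curve at time $t$ of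 the Hamiltonian vector field of $H$ starting at $\lambda$. Put $\mathbf h_q=\mathbf c_q^\perp$, $\mathbf v_q=\mathcal D_q^\perp$ (annihilators), so $C_q=\mathbb S_q^{k-1}\times\mathbf v_q$ with $\mathbb S_q^{k-1}=C_q\cap\mathbf h_q$ the unit sphere of $(\mathbf h_q,2H|_{\mathbf h_q})$. Then $$(L^{\mathbf c}\phi)(q)=\lim_{t\to0^+}\frac{2k}{t^2}\int_{C_q}\big(\phi(\exp_q(t,\lambda))-\phi(q)\big)\mu_q(\lambda),$$ where $\mu_q=\mu_{\mathbb S_q^{k-1}}\times\mu_{\mathbf v_q}$, with $\mu_{\mathbb S_q^{k-1}}$ the uniform probability measure and $\mu_{\mathbf v_q}$ a Borel probability measure on $\mathbf v_q$ for which linear functions are square-integrable and such that $q\mapsto\int_{C_q}f^2\mu_q$ is continuous for each continuous fiberwise linear $f:T^*M\to\mathbb R$ (e.g. $\mu_{\mathbf v_q}=\delta_0$). It is a fact that the limit exists, is independent of the choice of such measures, and in any local orthonormal frame $X_1,\dots,X_k$ of $\mathcal D$ completed by a local frame $X_{k+1},\dots,X_n$ of $\mathbf c$, with $[X_i,X_j]=\sum_\ell c_{ij}^\ell X_\ell$, equals $L^{\mathbf c}=\sum_{i=1}^kX_i^2+\sum_{i,j=1}^kc_{ji}^jX_i$. Popp's volume (when $\mathcal D+[\mathcal D,\mathcal D]=TM$): at $q\in M$, the map $\pi_2:\mathcal D_q\otimes\mathcal D_q\to T_qM/\mathcal D_q$, $\pi_2(v\otimes w)=[V,W](q)\bmod\mathcal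 D_q$ ($V,W$ horizontal extensions), is well defined and surjective; equip $T_qM/\mathcal D_q$ with the norm $\|u\|=\min\{\|e\|:\pi_2(e)=u\}$. Then $\mathcal P_q$ is the positive $n$-form with $|\mathcal P_q(v_1,\dots,v_n)|=1$ whenever $v_1,\dots,v_k$ is an orthonormal basis of $\mathcal D_q$ and the classes of the remaining vectors form an orthonormal basis of $T_qM/\mathcal D_q$. *)

(* Defs.v *)
From HB Require Import structures.
From mathcomp Require Import all_boot all_order all_algebra.
From mathcomp Require Import all_classical all_reals all_analysis.
From mathcomp Require Import ring lra.
Set Implicit Arguments.
Unset Strict Implicit.
Unset Printing Implicit Defensive.
Import Order.TTheory GRing.Theory Num.Theory numFieldNormedType.Exports.
Local Open Scope classical_set_scope.
Local Open Scope ring_scope.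

(* The manifold is R^n: points and tangent vectors are row vectors, covectors
   are column vectors, and [pairing l v] is <l, v>. *)
Section Calculus.
Context {R : realType} {n : nat}.
Implicit Types (q : 'rV[R]_n) (l : 'cV[R]_n) (V W : 'rV[R]_n -> 'rV[R]_n).

Definition pairing l (v : 'rV[R]_n) : R := (v *m l) 0 0.

Definition ker_form l : {vspace 'rV[R]_n} := lker (linfun (mulmxr l : _ -> 'M[R]_1)).

Definition annihilator (E : {vspace 'rV[R]_n}) : set 'cV[R]_n :=
  [set l | forall v, v \in E -> pairing l v = 0].

Definition iter_partial (s : seq 'I_n) (f : 'rV[R]_n -> R) : 'rV[R]_n -> R :=
  foldr (fun i h q => 'D_(delta_mx 0 i) h q) f s.

(* C^oo: the partial derivatives of all orders exist and are continuous. *)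
Definition smooth (f : 'rV[R]_n -> R) : Prop :=
  forall s : seq 'I_n,
    continuous (iter_partial s f) /\
    forall q i, derivable (iter_partial s f) q (delta_mx 0 i).

Definition smooth_field V : Prop := forall j, smooth (fun q => V q 0 j).

Definition lie_bracket V W : 'rV[R]_n -> 'rV[R]_n :=
  fun q => 'D_(V q) W q - 'D_(W q) V q.

(* A form of degree n is a function of a point and n tangent vectors;
   [volume_form rho] is rho dx_1 /\ ... /\ dx_n. *)
Definition volume_form (rho : 'rV[R]_n -> R) q (w : 'I_n -> 'rV[R]_n) : R :=
  rho q * \det (\matrix_i w i).

(* (L_V om)(w_1, .., w_n) = V(om(w_1, .., w_n)) - \sum_i om(w_1, .., [V, w_i], .., w_n)
   for constant fields w_i, for which [V, w_i] = - 'D_(w_i) V. *)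
Definition lie_derivative V (om : 'rV[R]_n -> ('I_n -> 'rV[R]_n) -> R) q
    (w : 'I_n -> 'rV[R]_n) : R :=
  'D_(V q) (fun y => om y w) q +
  \sum_i om q (fun j => if j == i then 'D_(w i) V q else w j).

Definition divergence (om : 'rV[R]_n -> ('I_n -> 'rV[R]_n) -> R) V q : R :=
  xget 0 [set d | forall w, lie_derivative V om q w = d * om q w].

(* The smooth local frames spanning c are taken to be restrictions of globally
   smooth fields, which is no loss (multiply by a bump function). *)
Definition smooth_subbundle (r : nat) (c : 'rV[R]_n -> {vspace 'rV[R]_n}) : Prop :=
  forall q, exists E : 'I_r -> 'rV[R]_n -> 'rV[R]_n,
    (forall i, smooth_field (E i)) /\
    \forall p \near q, basis_of (c p) [tuple E i p | i < r].

Definition is_complement (r : nat) (D c : 'rV[R]_n -> {vspace 'rV[R]_n}) : Prop :=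
  smooth_subbundle r c /\
  forall q, (D q + c q)%VS = fullv /\ (D q :&: c q)%VS = 0%VS.

End Calculus.

Section SubRiemannian.
Context {R : realType} {n k : nat}.
(* D is the distribution, F a global orthonormal frame of it. *)
Variables (D : 'rV[R]_n -> {vspace 'rV[R]_n}) (F : 'I_k -> 'rV[R]_n -> 'rV[R]_n).
Implicit Types (q v : 'rV[R]_n) (l : 'cV[R]_n).

Definition frame_at q : k.-tuple 'rV[R]_n := [tuple F i q | i < k].

(* The scalar product on D q for which the frame is orthonormal; it is only
   meaningful on vectors of D q. *)
Definition metric q (u v : 'rV[R]_n) : R :=
  \sum_i coord (frame_at q) i u * coord (frame_at q) i v.

Definition gradient (f : 'rV[R]_n -> R) q : 'rV[R]_n :=
  xget 0 [set u | u \in D q /\ forall v, v \in D q -> metric q u v = 'D_v f q].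

Definition macro_laplacian (om : 'rV[R]_n -> ('I_n -> 'rV[R]_n) -> R)
    (f : 'rV[R]_n -> R) : 'rV[R]_n -> R :=
  divergence om (gradient f).

Definition hamiltonian q l : R := 2^-1 * \sum_i pairing l (F i q) ^+ 2.

Definition integral_curve (I : set R) (x : R -> 'rV[R]_n) (p : R -> 'cV[R]_n) : Prop :=
  forall s, I s ->
    is_derive s 1 x
      (\row_j 'D_(delta_mx j 0) (hamiltonian (x s)) (p s)) /\
    is_derive s 1 p
      (- \col_j 'D_(delta_mx 0 j) (fun y => hamiltonian y (p s)) (x s)).

(* The value is q when the integral curve does not exist up to time t, which
   does not happen for 2 H(l) = 1 and t small: projections of such curves have
   unit speed. *)
Definition exp_map q (t : R) l : 'rV[R]_n :=
  xget q [set y | exists a b x p,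
    [/\ a < 0 < b, a < t < b, integral_curve `]a, b[ x p,
        x 0 = q /\ p 0 = l & y = x t]].

Definition cosphere_bundle q : set 'cV[R]_n := [set l | 2 * hamiltonian q l = 1].

Variable c : 'rV[R]_n -> {vspace 'rV[R]_n}.

Definition hor q : set 'cV[R]_n := annihilator (c q).
Definition ver q : set 'cV[R]_n := annihilator (D q).
Definition hor_sphere q : set 'cV[R]_n := cosphere_bundle q `&` hor q.

(* T*_q M with its Borel sigma-algebra. *)
Definition borel_covectors := g_sigma_algebraType (@open 'cV[R]_n).

(* The probability measure on the unit sphere of hor q invariant under the
   linear isometries of (hor q, 2H); any such isometry is the restriction of a
   linear endomorphism A of T*_q M. *)
Definition uniform_on_sphere q (mu : probability borel_covectors R) : Prop :=
  mu (hor_sphere q) = 1%E /\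
  forall A : 'M[R]_n,
    (forall l, hor q l ->
       hor q (A *m l) /\ hamiltonian q (A *m l) = hamiltonian q l) ->
  forall B : set borel_covectors, measurable B ->
    mu ((mulmx A : borel_covectors -> borel_covectors) @^-1` B) = mu B.

(* mu_q = muS q \x muV q, where (h, v) with h in hor_sphere q and v in ver q
   stands for the covector h + v of C_q. *)
Definition fiber_integral (muS muV : 'rV[R]_n -> probability borel_covectors R)
    q (f : 'cV[R]_n -> R) : R :=
  \int[(muS q \x muV q)%E]_(l in hor_sphere q `*` ver q)
     f ((l.1 : 'cV[R]_n) + (l.2 : 'cV[R]_n)).

Definition admissible_measures
    (muS muV : 'rV[R]_n -> probability borel_covectors R) : Prop :=
  [/\ forall q, uniform_on_sphere q (muS q),
      forall q, muV q (ver q) = 1%E,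
      forall q v, (muV q).-integrable setT
        (fun l : borel_covectors => (pairing l v ^+ 2)%:E)
    & forall f : 'rV[R]_n * 'cV[R]_n -> R,
        continuous f ->
        (forall q (a : R) (l l' : 'cV[R]_n),
           f (q, a *: l + l') = a * f (q, l) + f (q, l')) ->
        continuous (fun q => fiber_integral muS muV q (fun l => f (q, l) ^+ 2))].

Definition micro_laplacian (muS muV : 'rV[R]_n -> probability borel_covectors R)
    (f : 'rV[R]_n -> R) q : R :=
  lim ((2 * k%:R / t ^+ 2) *
       fiber_integral muS muV q (fun l => f (exp_map q t l) - f q) @[t --> 0^'+]).

(* An element of D_q (x) D_q is given by its coordinates e i j in the
   orthonormal basis F i (x) F j; [bracket_map q e] represents pi_2(e), to be
   read modulo D q. *)
Definition bracket_map q (e : 'M[R]_k) : 'rV[R]_n :=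
  \sum_i \sum_j e i j *: lie_bracket (F i) (F j) q.

Definition tensor_norm (e : 'M[R]_k) : R := Num.sqrt (\sum_i \sum_j e i j ^+ 2).

(* Norm of the class of u in T_q M / D q. *)
Definition quotient_norm q (u : 'rV[R]_n) : R :=
  inf [set tensor_norm e | e in [set e | bracket_map q e - u \in D q]].

Definition bracket_generating2 : Prop :=
  forall q u, exists e, bracket_map q e - u \in D q.

(* The condition on the w_l with k <= l says that their classes are orthonormal
   in T_q M / D q; there are n - k of them. *)
Definition adapted_basis q (w : 'I_n -> 'rV[R]_n) : Prop :=
  [/\ forall i : 'I_n, (i < k)%N -> w i \in D q,
      forall i j : 'I_n, (i < k)%N -> (j < k)%N -> metric q (w i) (w j) = (i == j)%:R
    & forall a : 'I_n -> R,
        quotient_norm q (\sum_(l < n | (k <= l)%N) a l *: w l) ^+ 2 =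
        \sum_(l < n | (k <= l)%N) a l ^+ 2].

Definition is_popp_volume (rho : 'rV[R]_n -> R) : Prop :=
  bracket_generating2 /\
  forall q, 0 < rho q /\
    forall w, adapted_basis q w -> `|volume_form rho q w| = 1.

End SubRiemannian.

Lemma metric_frame {R : realType} {n k : nat} (D : 'rV[R]_n -> {vspace 'rV[R]_n})
    (F : 'I_k -> 'rV[R]_n -> 'rV[R]_n) (q : 'rV[R]_n) i j :
  basis_of (D q) (frame_at F q) -> metric F q (F i q) (F j q) = (i == j)%:R.
Proof.
move=> /basis_free fr.
have h l m : coord (frame_at F q) l (F m q) = (l == m)%:R.
  by rewrite eq_sym -(coord_free m l fr) -tnth_nth tnth_mktuple.
rewrite /metric (bigD1 i) //= big1 ?h ?eqxx ?mul1r ?addr0 // => l li.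
by rewrite !h (negbTE li) mul0r.
Qed.

Section Example.
Context {R : realType}.
Implicit Types q : 'rV[R]_4.

Definition vec4 (a b c d : R) : 'rV[R]_4 := \row_(j < 4) [:: a; b; c; d]`_j.

(* q = (x, y, z, w) *)
Definition xc q : R := q 0 0.
Definition yc q : R := q 0 1.
Definition zc q : R := q 0 2.

Definition gfun q : R := expR (zc q).

Definition eta q : 'cV[R]_4 :=
  (gfun q / Num.sqrt 2) *: (vec4 (- (yc q / 2)) (xc q / 2) 0 1)^T.

Definition Dist q : {vspace 'rV[R]_4} := ker_form (eta q).

Definition fieldX q : 'rV[R]_4 := (Num.sqrt (gfun q))^-1 *: vec4 1 0 0 (2^-1 * yc q).
Definition fieldY q : 'rV[R]_4 := (Num.sqrt (gfun q))^-1 *: vec4 0 1 0 (- (2^-1 * xc q)).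
Definition fieldZ q : 'rV[R]_4 := (Num.sqrt (gfun q))^-1 *: vec4 0 0 1 0.

Definition frameXYZ (i : 'I_3) : 'rV[R]_4 -> 'rV[R]_4 :=
  tnth [tuple fieldX; fieldY; fieldZ] i.

Definition popp_density q : R := gfun q `^ (5 / 2) / Num.sqrt 2.

Lemma mem_Dist q v :
  (v \in Dist q) = (2 * v 0 3 == yc q * v 0 0 - xc q * v 0 1).
Proof.
rewrite memv_ker lfunE /= /eta -scalemxAr scaler_eq0 mulf_eq0 invr_eq0.
have g0 : gfun q == 0 = false by rewrite gt_eqF ?expR_gt0.
have s0 : Num.sqrt 2 == 0 :> R = false by rewrite gt_eqF ?sqrtr_gt0.
rewrite g0 s0 /=.
have m0 (m : 'M[R]_1) : (m == 0) = (m 0 0 == 0).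
  by apply/eqP/eqP => [->|h]; [rewrite mxE | apply/matrixP => i j; rewrite !ord1 h mxE].
rewrite m0 -[RHS]subr_eq0 mxE !big_ord_recl big_ord0 !mxE /=.
rewrite (_ : lift _ (lift _ (lift _ _)) = 3); last exact: val_inj.
rewrite (_ : lift _ (lift _ _) = 2); last exact: val_inj.
rewrite (_ : lift _ _ = 1); last exact: val_inj.
transitivity (2^-1 * (2 * v 0 3 - (yc q * v 0 0 - xc q * v 0 1)) == 0); last first.
  by rewrite mulf_eq0 invr_eq0 pnatr_eq0.
by congr (_ == _); rewrite /xc /yc; field.
Qed.

Lemma sg q : Num.sqrt (gfun q) != 0.
Proof. by rewrite gt_eqF // sqrtr_gt0 expR_gt0. Qed.

Lemma frameXYZ_basis q : basis_of (Dist q) (frame_at frameXYZ q).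
Proof.
have sE (a : 'I_3 -> R) : \sum_i a i *: (frame_at frameXYZ q)`_i =
   (Num.sqrt (gfun q))^-1 *: vec4 (a 0) (a 1) (a 2)
     (2^-1 * (yc q * a 0 - xc q * a 1)).
  rewrite !big_ord_recl big_ord0 -!tnth_nth !tnth_mktuple /frameXYZ !(tnth_nth 0) /=.
  rewrite (_ : lift _ (lift _ _) = 2); last exact: val_inj.
  rewrite (_ : lift _ _ = 1); last exact: val_inj.
  rewrite /fieldX /fieldY /fieldZ; apply/rowP => j; rewrite !mxE.
  by case: j => [[|[|[|[|//]]]] ?] /=; ring.
rewrite basisEfree; apply/and3P; split.
- apply/freeP => a; rewrite sE => /eqP; rewrite scaler_eq0 invr_eq0 (negbTE (sg q)) /=.
  move=> /eqP/rowP h i.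
  have h0 := h 0; have h1 := h 1; have h2 := h 2; rewrite !mxE /= in h0 h1 h2.
  by case: i => [[|[|[|//]]] ?];
    [rewrite -[RHS]h0|rewrite -[RHS]h1|rewrite -[RHS]h2]; congr a; exact: val_inj.
- apply/span_subvP => v /tnthP[i ->]; rewrite tnth_mktuple mem_Dist /frameXYZ (tnth_nth 0).
  by case: i => [[|[|[|//]]] ?] /=; rewrite !mxE /=; apply/eqP; field; exact: sg.
apply: leq_trans (dim_span _); apply: dimvS; apply/subvP => v.
rewrite mem_Dist => /eqP hv.
pose a (i : 'I_3) := Num.sqrt (gfun q) * v 0 (inord i).
suff -> : v = \sum_i a i *: (frame_at frameXYZ q)`_i.
  by apply: memv_suml => i _; apply: memvZ; apply: memv_span; rewrite mem_nth // size_tuple.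
rewrite sE; apply/rowP => j; rewrite !mxE /a.
have -> : inord (0%R : 'I_3) = 0%R :> 'I_4 by apply: val_inj; rewrite /= inordK.
have -> : inord (1%R : 'I_3) = 1%R :> 'I_4 by apply: val_inj; rewrite /= inordK.
have -> : inord (2%R : 'I_3) = 2%R :> 'I_4 by apply: val_inj; rewrite /= inordK.
case: j => [[|[|[|[|//]]]] p] /=.
- by rewrite mulKf ?sg //; congr (v _ _); exact: val_inj.
- by rewrite mulKf ?sg //; congr (v _ _); exact: val_inj.
- by rewrite mulKf ?sg //; congr (v _ _); exact: val_inj.
rewrite (_ : Ordinal p = 3); last exact: val_inj.
transitivity (2^-1 * (2 * v 0 3)); first by field.
by rewrite hv; field; exact: sg.
Qed.

End Example.

(* Main.v *)
Require Import Defs.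
From mathcomp Require Import all_boot all_order all_algebra.
From mathcomp Require Import all_classical all_reals all_analysis.
From mathcomp Require Import measurable_realfun ring lra.
Import Order.TTheory GRing.Theory Num.Theory numFieldNormedType.Exports.
Local Open Scope classical_set_scope.
Local Open Scope ring_scope.

(** The two Laplacians have the same principal part, so they can only differ by
a first-order operator, and its component along [Z] turns out not to depend on
the complement: the direction [Z] lies in the kernel of the restriction of
d eta to D, so it does not see how a complement is tilted. A test function of
[z] alone isolates this component, and the best choice is [g = e^z] itself
([expz]), for which both sides can be computed exactly, at the origin.

Microscopic side. The Hamiltonian is [e^(-z)] times a function of the other
variables, so along any integral curve with [2 H = 1] the momentum dual to [z]
grows at the constant rate [H = 1/2], while [e^z] has that momentum as its
derivative. Hence [e^z = 1 + r t + t^2/4] along every geodesic issued from the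
origin with initial covector [l], where [r = l_z] ([curve_expz]); this needs
only conservation laws, not uniqueness of solutions. Existence of the curve for
[|t| < 1] is obtained from explicit helices over the Heisenberg group
([integral_curve_exists]). The vertical part of the covector does not contribute
to [r], and the average of [r] over the sphere vanishes because the uniform
measure is invariant under [l |-> -l] ([uniform_odd_integral]); what remains is
[(6/t^2) (t^2/4) = 3/2], whatever the complement and the measures
([micro_laplacian_expz]).

Macroscopic side. The horizontal gradient of [e^z] is the coordinate field
d/dz, whose divergence is the logarithmic derivative 5/2 of the density
[g^(5/2)] ([macro_laplacian_expz]).

That the density is Popp's amounts to this: modulo D the only nonzero bracket
of the frame is [[X, Y]], so the norm of the quotient is [|eta|]
([quotient_norm_sqr]), and the volume form is the product of the dual coframe
of [X, Y, Z] with eta ([det_coframe]). *)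

Set Implicit Arguments.
Unset Strict Implicit.
Unset Printing Implicit Defensive.

(** * Directional derivatives *)

Section DirectionalDerivatives.
Context {R : realType} {V : normedModType R}.
Implicit Types (x v : V) (f g : V -> R).

(** Along a line, a directional derivative is an ordinary one; this transports the
chain rule of one real variable to functions on a normed space. *)
Lemma is_derive_line x v f d :
  is_derive (0 : R) 1 (fun h : R => f (h *: v + x)) d <-> is_derive x v f d.
Proof.
rewrite -[X in _ <-> X]/(is_derive x v f d).
have E : (fun h : R => h^-1 *: (((fun h : R => f (h *: v + x)) \o shift 0) (h *: 1)
           - f (0 *: v + x))) = (fun h : R => h^-1 *: ((f \o shift x) (h *: v) - f x)).
  by apply/funext => h /=; rewrite addr0 scaler1 scale0r add0r.
split=> -[D V1]; split.
- by rewrite /derivable -E.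
- by rewrite /derive -E.
- by rewrite /derivable E.
- by rewrite /derive E.
Qed.

Lemma derive_const x v (c : R) : is_derive x v (fun=> c) 0.
Proof. exact: is_derive_cst. Qed.

Lemma derive_add x v f g a b : is_derive x v f a -> is_derive x v g b ->
  is_derive x v (fun y => f y + g y) (a + b).
Proof. exact: is_deriveD. Qed.

Lemma derive_opp x v f a : is_derive x v f a -> is_derive x v (fun y => - f y) (- a).
Proof. exact: is_deriveN. Qed.

Lemma derive_mul x v f g a b : is_derive x v f a -> is_derive x v g b ->
  is_derive x v (fun y => f y * g y) (f x * b + g x * a).
Proof. exact: is_deriveM. Qed.

Lemma derive_sqr x v f a : is_derive x v f a ->
  is_derive x v (fun y => f y ^+ 2) (2 * f x * a).
Proof.
move=> fa; rewrite (_ : (fun y => _) = (fun y => f y * f y)); last first.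
  by apply/funext => y; rewrite expr2.
by apply: is_derive_eq (derive_mul fa fa) _; ring.
Qed.

Lemma derive_comp (h : R -> R) x v f a b :
  is_derive (f x) 1 h b -> is_derive x v f a ->
  is_derive x v (fun y => h (f y)) (b * a).
Proof.
move=> hb /is_derive_line fa; apply/(is_derive_line x v (fun y => h (f y)) (b * a)).
by apply: (@is_derive1_comp _ h (fun s : R => f (s *: v + x))); rewrite //= scale0r add0r.
Qed.

Lemma derive_expR x v f a : is_derive x v f a ->
  is_derive x v (fun y => expR (f y)) (expR (f x) * a).
Proof. exact: derive_comp. Qed.

End DirectionalDerivatives.

Lemma derive_coord {R : realType} {m n : nat} (q v : 'M[R]_(m, n)) i j :
  is_derive q v (fun y : 'M[R]_(m, n) => y i j) (v i j).
Proof.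
have [D E] := is_derive_id q v; split; first by have /derivable_mxP := D.
by rewrite -[in RHS]E derive_mx // mxE.
Qed.

Lemma is_derive_mx {R : realType} {V : normedModType R} {m n : nat}
    (M : V -> 'M[R]_(m, n)) x v (D : 'M[R]_(m, n)) :
  is_derive x v M D <-> forall i j, is_derive x v (fun y => M y i j) (D i j).
Proof.
split=> [[H <-] i j|H].
  by split; [have /derivable_mxP := H | rewrite derive_mx // mxE].
have H' : derivable M x v by apply/derivable_mxP => i j; case: (H i j).
by split=> //; rewrite derive_mx //; apply/matrixP => i j; rewrite mxE; case: (H i j).
Qed.

Lemma forall_ord4 (P : 'I_4 -> Prop) : P 0 -> P 1 -> P 2 -> P 3 -> forall i, P i.
Proof.
by move=> P0 P1 P2 P3 [[|[|[|[|//]]]] i];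
  [move: P0|move: P1|move: P2|move: P3]; congr P; apply: val_inj.
Qed.

Lemma sum_ord3 {V : nmodType} (F : 'I_3 -> V) : \sum_i F i = F 0 + F 1 + F 2.
Proof.
rewrite !big_ord_recl big_ord0 addr0 addrA.
by congr (_ + F _ + F _); apply: val_inj.
Qed.

Lemma sum_ord4 {V : nmodType} (F : 'I_4 -> V) : \sum_i F i = F 0 + F 1 + F 2 + F 3.
Proof.
rewrite !big_ord_recl big_ord0 addr0 !addrA.
by congr (_ + F _ + F _ + F _); apply: val_inj.
Qed.

(** * The Hamiltonian system of the frame X, Y, Z *)

Section HamiltonianSystem.
Context {R : realType}.
Implicit Types (q : 'rV[R]_4) (l : 'cV[R]_4) (x : R -> 'rV[R]_4) (p : R -> 'cV[R]_4).

Lemma frameXYZE q :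
  (frameXYZ 0 q = fieldX q) * (frameXYZ 1 q = fieldY q) * (frameXYZ 2 q = fieldZ q).
Proof. by rewrite /frameXYZ !(tnth_nth fieldX). Qed.

Lemma pairingE l q : pairing l q = q 0 0 * l 0 0 + q 0 1 * l 1 0 + q 0 2 * l 2 0 + q 0 3 * l 3 0.
Proof. by rewrite /pairing mxE sum_ord4. Qed.

Lemma vec4E (a b c d : R) :
  (vec4 a b c d 0 0 = a) * (vec4 a b c d 0 1 = b) * (vec4 a b c d 0 2 = c) *
  (vec4 a b c d 0 3 = d).
Proof. by rewrite !mxE. Qed.

(** [expR (- z)] times [momX] and [momY] are the velocities of the [x] and [y]
coordinates; they are the momenta of the left-invariant fields of the Heisenberg
group. *)
Definition momX q l : R := l 0 0 + 2^-1 * yc q * l 3 0.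
Definition momY q l : R := l 1 0 - 2^-1 * xc q * l 3 0.

Lemma gfunV q : (gfun q)^-1 = expR (- q 0 2).
Proof. by rewrite /gfun /zc expRN. Qed.

Lemma hamiltonianE q l : hamiltonian frameXYZ q l =
  2^-1 * (expR (- q 0 2) * (momX q l ^+ 2 + momY q l ^+ 2 + l 2 0 ^+ 2)).
Proof.
rewrite /hamiltonian sum_ord3 !frameXYZE /fieldX /fieldY /fieldZ !pairingE.
rewrite ![((_ *: _) : 'rV__) _ _]mxE !vec4E -gfunV -[in RHS](@sqr_sqrtr _ (gfun q)) ?expR_ge0 //.
have := sg q; set r := Num.sqrt _ => r0.
by rewrite /momX /momY; field.
Qed.

Ltac derive_by_rules := repeat first
  [ eassumption | apply: derive_const | apply: derive_coord | apply: derive_sqr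
  | apply: derive_add | apply: derive_opp | apply: derive_mul | apply: derive_expR].

Lemma derive_hamiltonian_covector q l (v : 'cV[R]_4) :
  is_derive l v (hamiltonian frameXYZ q)
    (expR (- q 0 2) * (momX q l * (v 0 0 + 2^-1 * yc q * v 3 0) +
       momY q l * (v 1 0 - 2^-1 * xc q * v 3 0) + l 2 0 * v 2 0)).
Proof.
rewrite (funext (hamiltonianE q)) /momX /momY.
apply: is_derive_eq; first by derive_by_rules.
by rewrite /=; field.
Qed.

Lemma derive_hamiltonian_point q l (v : 'rV[R]_4) :
  is_derive q v (fun y => hamiltonian frameXYZ y l)
    (expR (- q 0 2) * l 3 0 / 2 * (momX q l * v 0 1 - momY q l * v 0 0)
     - hamiltonian frameXYZ q l * v 0 2).
Proof.
rewrite (_ : (fun y => _) = (fun y : 'rV[R]_4 => 2^-1 * (expR (- y 0 2) *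
  (momX y l ^+ 2 + momY y l ^+ 2 + l 2 0 ^+ 2)))); last first.
  by apply/funext => y; exact: hamiltonianE.
rewrite hamiltonianE /momX /momY /xc /yc.
apply: is_derive_eq; first by derive_by_rules.
by rewrite /=; field.
Qed.

(** Hamilton's equations in coordinates, in the form used in both directions: to
derive conservation laws along any curve, and to recognize an explicit one. *)
Lemma integral_curveP (I : set R) x p :
  integral_curve frameXYZ I x p <-> forall s, I s ->
  let A := expR (- x s 0 2) * momX (x s) (p s) in
  let B := expR (- x s 0 2) * momY (x s) (p s) in
  let dx i d := is_derive s 1 (fun t => x t 0 i) d in
  let dp i d := is_derive s 1 (fun t => p t i 0) d in
  [/\ dx 0 A, dx 1 B, dx 2 (expR (- x s 0 2) * p s 2 0)
    & dx 3 (2^-1 * (yc (x s) * A - xc (x s) * B))] /\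
  [/\ dp 0 (2^-1 * p s 3 0 * B), dp 1 (- (2^-1 * p s 3 0 * A)),
      dp 2 (hamiltonian frameXYZ (x s) (p s)) & dp 3 0].
Proof.
split=> H s Is.
- have [/is_derive_mx Hx /is_derive_mx Hp] := H s Is.
  split; split;
  [ apply: is_derive_eq (Hx 0 0) _ | apply: is_derive_eq (Hx 0 1) _
  | apply: is_derive_eq (Hx 0 2) _ | apply: is_derive_eq (Hx 0 3) _
  | apply: is_derive_eq (Hp 0 0) _ | apply: is_derive_eq (Hp 1 0) _
  | apply: is_derive_eq (Hp 2 0) _ | apply: is_derive_eq (Hp 3 0) _ ];
  rewrite !mxE ?(@derive_val _ _ _ _ _ _ _ (derive_hamiltonian_covector _ _ _))
    ?(@derive_val _ _ _ _ _ _ _ (derive_hamiltonian_point _ _ _)) !mxE /=;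
  by field.
have [[x0 x1 x2 x3] [p0 p1 p2 p3]] := H s Is.
split; apply/is_derive_mx.
- move=> i; rewrite ord1 => {i}; apply: forall_ord4;
  [ apply: is_derive_eq x0 _ | apply: is_derive_eq x1 _
  | apply: is_derive_eq x2 _ | apply: is_derive_eq x3 _ ];
  rewrite !mxE ?(@derive_val _ _ _ _ _ _ _ (derive_hamiltonian_covector _ _ _)) !mxE /=; by field.
apply: forall_ord4 => i; rewrite ord1 => {i};
  [ apply: is_derive_eq p0 _ | apply: is_derive_eq p1 _
  | apply: is_derive_eq p2 _ | apply: is_derive_eq p3 _ ];
  rewrite !mxE ?(@derive_val _ _ _ _ _ _ _ (derive_hamiltonian_point _ _ _)) !mxE /=; by field.
Qed.
End HamiltonianSystem.

(** * Conservation laws *)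

Lemma derive0_constant {R : realType} (a b : R) (f : R -> R) :
  (forall s, a < s < b -> is_derive s 1 f 0) ->
  forall s t, a < s < b -> a < t < b -> f s = f t.
Proof.
move=> f'0; suff lt_cst s t : a < s -> s < t -> t < b -> f s = f t.
  move=> s t /andP[a_s s_b] /andP[a_t t_b].
  by have [st|ts|->//] := ltgtP s t; [exact: lt_cst | apply/esym; exact: lt_cst].
move=> a_s st t_b.
have [||c _] := @MVT _ f (fun=> 0) s t st.
- move=> r; rewrite in_itv /= => /andP[sr rt]; apply: f'0.
  by rewrite (lt_trans a_s) // (lt_trans rt).
- apply: derivable_within_continuous => r; rewrite in_itv /= => /andP[sr rt].
  by have [] : is_derive r 1 f 0 by apply: f'0; rewrite (lt_le_trans a_s) // (le_lt_trans rt).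
by rewrite mul0r => /eqP; rewrite subr_eq0 => /eqP.
Qed.

Section Motion.
Context {R : realType} (a b : R) (x : R -> 'rV[R]_4) (p : R -> 'cV[R]_4).
Hypotheses (ab : a < 0 < b) (xp : integral_curve frameXYZ `]a, b[ x p).

Lemma curve_energy t : a < t < b ->
  hamiltonian frameXYZ (x t) (p t) = hamiltonian frameXYZ (x 0) (p 0).
Proof.
move=> tab.
apply: (@derive0_constant _ a b (fun s => hamiltonian frameXYZ (x s) (p s))) => // s sab.
have [|[x0 x1 x2 x3] [p0 p1 p2 p3]] := (integral_curveP _ _ _).1 xp s; first by [].
rewrite (funext (fun t => hamiltonianE (x t) (p t))) /momX /momY /xc /yc.
apply: is_derive_eq; rewrite hamiltonianE /momX /momY /xc /yc /GRing.scale /=.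
by field.
Qed.

(** The Hamiltonian depends on [z] through the factor [e^(-z)] only, so the force
[- dH/dz] equals [H], which is conserved. *)
Lemma curve_momentum t : a < t < b ->
  p t 2 0 = p 0 2 0 + hamiltonian frameXYZ (x 0) (p 0) * t.
Proof.
move=> tab; pose f s := p s 2 0 - hamiltonian frameXYZ (x 0) (p 0) * s.
suff : f t = f 0 by rewrite /f mulr0 subr0 => /eqP; rewrite subr_eq => /eqP.
apply: (@derive0_constant _ a b) => // s sab.
have [|[x0 x1 x2 x3] [p0 p1 p2 p3]] := (integral_curveP _ _ _).1 xp s; first by [].
apply: is_derive_eq; rewrite curve_energy // /GRing.scale /=.
by ring.
Qed.

(** The derivative of [e^z] along the curve is [e^z e^(-z) p_z = p_z], an affine
function of time. *)
Lemma curve_expz t : a < t < b ->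
  expR (x t 0 2) =
  expR (x 0 0 2) + p 0 2 0 * t + hamiltonian frameXYZ (x 0) (p 0) / 2 * t ^+ 2.
Proof.
move=> tab; set H := hamiltonian _ _ _.
pose f s := expR (x s 0 2) - (p 0 2 0 * s + H / 2 * s ^+ 2).
suff : f t = f 0.
  by rewrite /f mulr0 expr0n mulr0 addr0 subr0 => /eqP; rewrite subr_eq addrA => /eqP.
apply: (@derive0_constant _ a b) => // s sab.
have [|[x0 x1 x2 x3] [p0 p1 p2 p3]] := (integral_curveP _ _ _).1 xp s; first by [].
apply: is_derive_eq; rewrite curve_momentum // expRN /GRing.scale /= -/H.
by field; rewrite gt_eqF ?expR_gt0.
Qed.

End Motion.

(** * Existence of the geodesics issued from the origin *)

(** These are [sin (k s) / k], [(1 - cos (k s)) / k] and [(s - sin (k s) / k) / (2 k)],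
extended by continuity to [k = 0]; stating them through their differential
equations lets straight and helical geodesics be treated together. *)
Lemma circular_arc_functions {R : realType} (k : R) : exists S C W : R -> R,
  [/\ S 0 = 0, C 0 = 0, W 0 = 0 & forall s : R,
    [/\ is_derive s 1 S (1 - k * C s), is_derive s 1 C (k * S s),
        is_derive s 1 W (C s / 2) & k * (S s ^+ 2 + C s ^+ 2) = 2 * C s]].
Proof.
have [->|k0] := eqVneq k 0.
  exists id, (fun=> 0), (fun=> 0); split=> // s; split; last by ring.
  - by apply: is_derive_eq (is_derive_id _ _) _; rewrite mul0r subr0.
  - by apply: is_derive_eq (derive_const _ _ _) _; rewrite mul0r.
  - by apply: is_derive_eq (derive_const _ _ _) _; rewrite mul0r.
have dk (s : R) : is_derive s 1 (fun s : R => k * s) k.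
  apply: is_derive_eq (derive_mul (derive_const _ _ k) (is_derive_id _ _)) _.
  by rewrite /=; ring.
have dS (s : R) : is_derive s 1 (fun s : R => k^-1 * sin (k * s)) (cos (k * s)).
  apply: is_derive_eq (derive_mul (derive_const _ _ _) (derive_comp (is_derive_sin _) (dk s))) _.
  by rewrite /=; field.
have dC (s : R) : is_derive s 1 (fun s : R => k^-1 * (1 - cos (k * s))) (sin (k * s)).
  apply: is_derive_eq (derive_mul (derive_const _ _ _) (derive_add (derive_const _ _ _)
    (derive_opp (derive_comp (is_derive_cos _) (dk s))))) _.
  by rewrite /=; field.
exists (fun s : R => k^-1 * sin (k * s)), (fun s : R => k^-1 * (1 - cos (k * s))),
  (fun s : R => (2 * k)^-1 * (s - k^-1 * sin (k * s))).
split; rewrite ?mulr0 ?sin0 ?cos0 ?subrr ?mulr0 ?subr0 ?mulr0 // => s; split.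
- by apply: is_derive_eq (dS s) _; field.
- by apply: is_derive_eq (dC s) _; field.
- apply: is_derive_eq (derive_mul (derive_const _ _ _)
    (derive_add (is_derive_id _ _) (derive_opp (dS s)))) _.
  by rewrite /=; field.
by rewrite !exprMn sin2cos2; field.
Qed.

Lemma expz_quadratic_gt0 {R : realType} (r t : R) :
  r ^+ 2 <= 1 -> -1 < t < 1 -> 0 < 1 + r * t + t ^+ 2 / 4.
Proof. by move=> r1 /andP[t0 t1]; nra. Qed.

(** The quadratic equals [d^2 + (t/2 + r)^2], so its inverse has an arctangent as
primitive when [d] is nonzero. When [d = 0] the curve has no motion in the
[x], [y], [w] directions and any reparametrization will do; this is why the
derivative is only required after multiplication by [d]. *)
Lemma inverse_expz_primitive {R : realType} (d r : R) : r ^+ 2 + d ^+ 2 = 1 ->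
  exists s : R -> R, s 0 = 0 /\ forall t : R, -1 < t < 1 ->
    exists2 ds, is_derive t 1 s ds & d * ds = d / (1 + r * t + t ^+ 2 / 4).
Proof.
move=> rd; have [->|d0] := eqVneq d 0.
  exists (fun=> 0); split=> // t _; exists 0; first exact: derive_const.
  by rewrite !mul0r.
pose h (t : R) := d^-1 * (t / 2 + r).
exists (fun t => 2 / d * (atan (h t) - atan (h 0))); split=> [|t t1].
  by rewrite subrr mulr0.
have dh : is_derive t 1 h (2 * d)^-1.
  apply: is_derive_eq (derive_mul (derive_const _ _ d^-1)
    (derive_add (derive_mul (is_derive_id t (1 : R)) (derive_const _ _ 2^-1))
       (derive_const _ _ r))) _.
  by rewrite /=; field.
exists (2 / d * ((1 + h t ^+ 2)^-1 * (2 * d)^-1)).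
  apply: is_derive_eq (derive_mul (derive_const _ _ (2 / d))
    (derive_add (derive_comp (is_derive1_atan (h t)) dh) (derive_const _ _ (- atan (h 0))))) _.
  by rewrite /=; ring.
have Q0 : 0 < 1 + r * t + t ^+ 2 / 4.
  by apply: expz_quadratic_gt0 t1; rewrite -rd lerDl sqr_ge0.
have E : 1 + r * t + t ^+ 2 / 4 = d ^+ 2 + (t / 2 + r) ^+ 2.
  by rewrite -[X in X + _ + _]rd; field.
move: Q0; rewrite E /h => Q0; field.
by rewrite d0 andbT gt_eqF //; lra.
Qed.

(** In the time [s] with [ds = e^(-z) dt], the [x], [y], [w] coordinates follow a
geodesic of the Heisenberg group: [(x, y)] runs along an arc of a circle of
curvature proportional to [k = p_w], and [w] is the area swept, up to
sign. *)
Lemma integral_curve_exists {R : realType} (l : 'cV[R]_4) :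
  cosphere_bundle frameXYZ 0 l ->
  exists x p, [/\ integral_curve frameXYZ `]-1, 1[ x p, x 0 = 0 & p 0 = l].
Proof.
rewrite /cosphere_bundle /= hamiltonianE /momX /momY /xc /yc !mxE oppr0 expR0.
set u := l 0 0; set v := l 1 0; set r := l 2 0; set k := l 3 0 => Hl.
have uvr : u ^+ 2 + v ^+ 2 + r ^+ 2 = 1 by rewrite -Hl; field.
have [S [C [W [S0 C0 W0 SCW]]]] := circular_arc_functions k.
(* the conserved length of the Heisenberg momentum *)
pose d := Num.sqrt (u ^+ 2 + v ^+ 2).
have dE : d ^+ 2 = u ^+ 2 + v ^+ 2 by rewrite sqr_sqrtr // addr_ge0 ?sqr_ge0.
have [|s [s0 ds]] := @inverse_expz_primitive _ d r; first by rewrite dE -uvr; ring.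
pose Q (t : R) := 1 + r * t + t ^+ 2 / 4.
pose X t := u * S (s t) + v * C (s t); pose Y t := v * S (s t) - u * C (s t).
exists (fun t => vec4 (X t) (Y t) (ln (Q t)) (d ^+ 2 * W (s t))),
  (fun t => (vec4 (u + k / 2 * Y t) (v - k / 2 * X t) (r + t / 2) k)^T).
have Q01 : Q 0 = 1 by rewrite /Q; ring.
have X0 : X 0 = 0 by rewrite /X s0 S0 C0 !mulr0 addr0.
have Y0 : Y 0 = 0 by rewrite /Y s0 S0 C0 !mulr0 subr0.
split; last 2 first.
- rewrite X0 Y0 Q01 s0 W0 ln1 mulr0.
  by apply/matrixP => i; rewrite ord1 => {i}; apply: forall_ord4; rewrite !mxE.
- rewrite X0 Y0 !mulr0 mul0r subr0 !addr0.
  by apply/matrixP; apply: forall_ord4 => i; rewrite ord1 !mxE.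
apply/integral_curveP => t; rewrite /= in_itv /= => t1.
have {ds}[ds dst dds] := ds t t1.
have r1 : r ^+ 2 <= 1 by rewrite -uvr lerDr addr_ge0 ?sqr_ge0.
have Q0 : 0 < Q t := expz_quadratic_gt0 r1 t1.
(* [u] and [v] vanish with [d], so they can replace it in [dds] *)
have cancel_d y : (d = 0 -> y = 0) -> y * ds = y / Q t.
  move=> dy; have [/dy ->|d0] := eqVneq d 0; first by rewrite !mul0r.
  by apply: (mulfI d0); rewrite mulrCA dds mulrCA.
have d0uv : d = 0 -> u = 0 /\ v = 0.
  by move=> d0; move: dE; rewrite d0 expr0n /= => /esym/eqP;
    rewrite paddr_eq0 ?sqr_ge0 // !sqrf_eq0 => /andP[/eqP-> /eqP->].
have uds : u * ds = u / Q t by apply: cancel_d => /d0uv[].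
have vds : v * ds = v / Q t by apply: cancel_d => /d0uv[].
have [dS dC dW SC] := SCW (s t).
have dX : is_derive t 1 X ((u + k * Y t) / Q t).
  apply: is_derive_eq (derive_add
    (derive_mul (derive_const _ _ u) (derive_comp dS dst))
    (derive_mul (derive_const _ _ v) (derive_comp dC dst))) _.
  rewrite /= !mulr0 !addr0.
  transitivity ((u * ds) * (1 - k * C (s t)) + (v * ds) * (k * S (s t))); first by ring.
  by rewrite uds vds /Y; ring.
have dY : is_derive t 1 Y ((v - k * X t) / Q t).
  apply: is_derive_eq (derive_add
    (derive_mul (derive_const _ _ v) (derive_comp dS dst))
    (derive_opp (derive_mul (derive_const _ _ u) (derive_comp dC dst)))) _.
  rewrite /= !mulr0 !addr0.
  transitivity ((v * ds) * (1 - k * C (s t)) - (u * ds) * (k * S (s t))); first by ring.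
  by rewrite uds vds /X; ring.
have dQ : is_derive t 1 Q (r + t / 2).
  apply: is_derive_eq (derive_add (derive_add (derive_const _ _ 1)
    (derive_mul (derive_const _ _ r) (is_derive_id t (1 : R))))
    (derive_mul (derive_sqr (is_derive_id t (1 : R))) (derive_const _ _ 4^-1))) _.
  by rewrite /=; field.
have uvk : (u + k * Y t) ^+ 2 + (v - k * X t) ^+ 2 = d ^+ 2.
  transitivity (d ^+ 2 + k * d ^+ 2 * (k * (S (s t) ^+ 2 + C (s t) ^+ 2) - 2 * C (s t))).
    by rewrite dE /X /Y; ring.
  by rewrite SC subrr mulr0 addr0.
have xE : forall i, (fun t => vec4 (X t) (Y t) (ln (Q t)) (d ^+ 2 * W (s t)) 0 i) =
    [:: X; Y; fun t => ln (Q t); fun t => d ^+ 2 * W (s t)]`_i.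
  by apply: forall_ord4; apply/funext => t'; rewrite mxE.
have pE : forall i, (fun t => (vec4 (u + k / 2 * Y t) (v - k / 2 * X t) (r + t / 2) k)^T i 0) =
    [:: fun t => u + k / 2 * Y t; fun t => v - k / 2 * X t; fun t => r + t / 2; fun=> k]`_i.
  by apply: forall_ord4; apply/funext => t'; rewrite !mxE.
rewrite hamiltonianE /momX /momY /xc /yc ![(_ ^T) _ _]mxE !vec4E !xE !pE /=.
rewrite expRN lnK ?posrE //.
have AE : u + k / 2 * Y t + 2^-1 * Y t * k = u + k * Y t by field.
have BE : v - k / 2 * X t - 2^-1 * X t * k = v - k * X t by field.
rewrite AE BE; split; split=> //.
- by apply: is_derive_eq dX _; rewrite mulrC.
- by apply: is_derive_eq dY _; rewrite mulrC.
- by apply: is_derive_eq (derive_comp (is_derive1_ln Q0) dQ) _.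
- apply: is_derive_eq (derive_mul (derive_const _ _ (d ^+ 2)) (derive_comp dW dst)) _.
  rewrite /= mulr0 addr0.
  transitivity ((u * (u * ds) + v * (v * ds)) * (C (s t) / 2)); first by rewrite dE; ring.
  rewrite uds vds; transitivity (2^-1 * (Q t)^-1 *
    (- (u ^+ 2 + v ^+ 2) * C (s t) +
     (u ^+ 2 + v ^+ 2) * (k * (S (s t) ^+ 2 + C (s t) ^+ 2)))); last by rewrite /X /Y; ring.
  by rewrite SC; ring.
- apply: is_derive_eq (derive_add (derive_const _ _ u)
    (derive_mul (derive_const _ _ (k / 2)) dY)) _.
  by rewrite /=; ring.
- apply: is_derive_eq (derive_add (derive_const _ _ v)
    (derive_opp (derive_mul (derive_const _ _ (k / 2)) dX))) _.
  by rewrite /=; ring.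
- apply: is_derive_eq (derive_add (derive_const _ _ r)
    (derive_mul (is_derive_id t (1 : R)) (derive_const _ _ 2^-1))) _.
  have -> : (u + k * Y t) ^+ 2 + (v - k * X t) ^+ 2 + (r + t / 2) ^+ 2 = Q t.
    by rewrite uvk dE /Q -[X in _ = X + _ + _]uvr; field.
  by rewrite /= mulVf ?gt_eqF //; ring.
exact: derive_const.
Qed.

(** Any curve the choice operator may select satisfies the conservation laws, so
only the existence of one curve has to be known. *)
Lemma exp_map_expz {R : realType} (l : 'cV[R]_4) (t : R) :
  cosphere_bundle frameXYZ 0 l -> 0 < t < 1 ->
  expR (exp_map frameXYZ 0 t l 0 2) = 1 + l 2 0 * t + t ^+ 2 / 4.
Proof.
move=> Hl /andP[t0 t1]; rewrite /exp_map.
case: xgetP => [y _ /= [a [b [x [p [ab tab xp [x0 p0] ->]]]]]|none].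
  rewrite (curve_expz ab xp tab) x0 p0 mxE expR0.
  have -> : hamiltonian frameXYZ 0 l = 2^-1 by move: Hl; rewrite /cosphere_bundle /=; lra.
  by field.
have [x [p [xp x0 p0]]] := integral_curve_exists Hl.
case: (none (x t)); exists (-1), 1, x, p; split=> //; first lra.
by rewrite t1 andbT (lt_trans _ t0) // ltrN10.
Qed.

(** * Integrals over the fibers *)

(** The set of points over the complement of [B] is negligible, and the first
marginal of the product measure is [P1]. *)
Lemma Rintegral_prod_fst {R : realType} d1 d2 (T1 : measurableType d1) (T2 : measurableType d2)
    (P1 : probability T1 R) (P2 : probability T2 R) (A : set T1) (B : set T2) (f : T1 -> R) :
  measurable A -> measurable B -> P2 B = 1%E -> measurable_fun setT f ->
  [bounded f x | x in A] ->
  \int[(P1 \x P2)%E]_(z in A `*` B) f z.1 = \int[P1]_(x in A) f x.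
Proof.
move=> mA mB PB mf bf; congr fine.
have mE : measurable_fun setT (fun x => (f x)%:E) by exact/measurable_EFinP.
have mAT : measurable (fst @^-1` A : set (T1 * T2)).
  by rewrite -[X in measurable X]setTI; exact: measurable_fst.
have mfst : measurable_fun (fst @^-1` A : set (T1 * T2)) (f \o fst).
  by apply: measurable_funTS; apply: measurableT_comp => //; exact: measurable_fst.
have int_f : (P1 \x P2)%E.-integrable (fst @^-1` A) ((fun x => (f x)%:E) \o fst).
  apply: (@measurable_bounded_integrable _ _ _ _ (f \o fst)) => //.
    by rewrite (le_lt_trans (probability_le1 _ _)) // ltry.
  by have [M [Mr H]] := bf; exists M; split=> // N MN z /= Az; exact: H.
transitivity (\int[pushforward (P1 \x P2)%E fst]_(x in A) (f x)%:E)%E; last first.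
  apply: eq_measure_integral => S mS _.
  transitivity ((P1 \x P2)%E (S `*` setT)).
    by apply: (congr1 (P1 \x P2)%E); apply/seteqP; split=> [[s t]|[s t] []].
  by rewrite product_measure1E // [X in (_ * X)%E]probability_setT mule1.
rewrite integral_pushforward //.
rewrite [RHS](@negligible_integral _ _ _ _ _ (setT `*` ~` B)) //.
- congr (integral _ _ _); apply/seteqP; split=> [[s t] [/= As Bt]|[s t] [/= As nB]].
    by split=> //= -[].
  by split=> //=; apply: contrapT => nBt; apply: nB.
- by apply: measurableX => //; exact: measurableC.
- transitivity ((P1 \x P2)%E (setT `*` ~` B)) => //.
  have PnB : P2 (~` B) = 0%E by rewrite probability_setC // PB subee.
  by rewrite product_measure1E //; [rewrite [X in (_ * X)%E]PnB mule0 | exact: measurableC].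
Qed.

Section Covectors.
Context {R : realType} {n : nat}.
Notation covectors := (@borel_covectors R n).

Lemma closed_borel_covectors (A : set 'cV[R]_n) : closed A -> measurable (A : set covectors).
Proof.
move=> cA; rewrite -[A]setCK; apply: measurableC; apply: sub_sigma_algebra.
exact: closed_openC.
Qed.

Lemma continuous_borel_covectors (f : 'cV[R]_n -> R) :
  continuous f -> measurable_fun setT (f : covectors -> R).
Proof.
move=> /continuousP cf; apply: (measurability _ (RGenOpens.measurableE R)).
move=> _ [_ [a [b ->] <-]]; rewrite setTI; apply: sub_sigma_algebra.
by apply: cf; exact: interval_open.
Qed.

Lemma continuous_mul (T : topologicalType) (f g : T -> R) :
  continuous f -> continuous g -> continuous (fun x => f x * g x).
Proof. by move=> cf cg x; exact: continuousM (cf x) (cg x). Qed.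

Lemma continuous_pairing (v : 'rV[R]_n) : continuous (fun l : 'cV[R]_n => pairing l v).
Proof.
rewrite (_ : (fun l => _) = (fun l : 'cV[R]_n => \sum_i v 0 i * l i 0)); last first.
  by apply/funext => l; rewrite /pairing mxE.
apply: continuous_big => [|i _]; first exact: add_continuous.
by apply: continuous_mul; [exact: cst_continuous | exact: coord_continuous].
Qed.

Lemma annihilator_closed (E : {vspace 'rV[R]_n}) : closed (annihilator E).
Proof.
rewrite (_ : annihilator E = \bigcap_(v in [set v | v \in E]) [set l | pairing l v = 0]) //.
apply: closed_bigI => v _.
apply: (@preimage_closed _ _ (fun l => pairing l v) [set x | x = 0]).
  by move=> l _; exact: continuous_pairing.
exact: closed_eq.
Qed.

Lemma continuous_hamiltonian k (F : 'I_k -> 'rV[R]_n -> 'rV[R]_n) q :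
  continuous (hamiltonian F q).
Proof.
rewrite (_ : hamiltonian F q = fun l => 2^-1 * \sum_i pairing l (F i q) * pairing l (F i q));
  last by apply/funext => l; congr (_ * _); apply: eq_bigr => i _; rewrite expr2.
apply: continuous_mul; first exact: cst_continuous.
apply: continuous_big => [|i _]; first exact: add_continuous.
by apply: continuous_mul; exact: continuous_pairing.
Qed.

Lemma hor_sphere_closed k (F : 'I_k -> 'rV[R]_n -> 'rV[R]_n) c q :
  closed (hor_sphere F c q).
Proof.
apply: closedI; last exact: annihilator_closed.
apply: (@preimage_closed _ _ (fun l => 2 * hamiltonian F q l) [set x | x = 1]).
  move=> l _; move: l; apply: continuous_mul; first exact: cst_continuous.
  exact: continuous_hamiltonian.
exact: closed_eq.
Qed.

Lemma pairingN (l : 'cV[R]_n) v : pairing (- l) v = - pairing l v.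
Proof. by rewrite /pairing mulmxN mxE. Qed.

Lemma annihilatorN (E : {vspace 'rV[R]_n}) l : annihilator E l -> annihilator E (- l).
Proof. by move=> h v /h; rewrite pairingN => ->; rewrite oppr0. Qed.

Lemma hamiltonianN k (F : 'I_k -> 'rV[R]_n -> 'rV[R]_n) q l :
  hamiltonian F q (- l) = hamiltonian F q l.
Proof. by congr (_ * _); apply: eq_bigr => i _; rewrite pairingN sqrrN. Qed.

Lemma hor_sphereN k (F : 'I_k -> 'rV[R]_n -> 'rV[R]_n) c q l :
  hor_sphere F c q l -> hor_sphere F c q (- l).
Proof.
by move=> [/= Hl hl]; split; [rewrite /cosphere_bundle /= hamiltonianN | exact: annihilatorN].
Qed.

(** The opposite map is a linear isometry, so the invariance of the measure
equates the integral with its opposite. *)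
Lemma uniform_odd_integral k (F : 'I_k -> 'rV[R]_n -> 'rV[R]_n) c q
    (mu : probability covectors R) (v : 'rV[R]_n) :
  uniform_on_sphere F c q mu ->
  [bounded pairing l v | l in (hor_sphere F c q : set covectors)] ->
  \int[mu]_(l in (hor_sphere F c q : set covectors)) pairing l v = 0.
Proof.
move=> [_ inv] bd; pose S : set covectors := hor_sphere F c q.
rewrite -[X in Rintegral _ X _]/S.
have mS : measurable S by apply: closed_borel_covectors; exact: hor_sphere_closed.
have mp : measurable_fun setT (fun l : covectors => pairing (l : 'cV[R]_n) v).
  by apply: continuous_borel_covectors; exact: continuous_pairing.
have int_p : mu.-integrable S (EFin \o (fun l : covectors => pairing (l : 'cV[R]_n) v)).
  apply: measurable_bounded_integrable => //; last exact: measurable_funTS.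
  by rewrite (le_lt_trans (probability_le1 _ _)) // ltry.
pose N : covectors -> covectors := fun l : 'cV[R]_n => (-1)%:M *m l.
have NE (l : 'cV[R]_n) : N l = - l by rewrite /N mul_scalar_mx scaleN1r.
have mN : measurable_fun setT N.
  apply: (@measurability _ _ covectors covectors setT N (@open 'cV[R]_n)) => //.
  move=> _ [B oB <-]; rewrite setTI.
  apply: sub_sigma_algebra; apply: open_comp oB => l _.
  rewrite (funext NE); exact: opp_continuous.
have SN : N @^-1` S = S.
  by apply/seteqP; split=> l; rewrite /= NE => /hor_sphereN; rewrite ?opprK.
have invN B : measurable B -> mu (N @^-1` B) = mu B.
  apply: inv => l hl; rewrite mul_scalar_mx scaleN1r hamiltonianN.
  by split=> //; exact: annihilatorN.
set I := Rintegral _ _ _; suff : I = - I by move=> h; lra.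
transitivity (fine (\int[pushforward mu N]_(l in S) (pairing (l : 'cV[R]_n) v)%:E)%E).
  by congr fine; apply: eq_measure_integral => B mB _; apply/esym; exact: invN.
have fN : (fun l : covectors => (pairing (l : 'cV[R]_n) v)%:E) \o N =
    (fun l : covectors => - (pairing (l : 'cV[R]_n) v)%:E)%E.
  by apply/funext => l; rewrite /= NE pairingN.
rewrite integral_pushforward //; last 2 first.
- exact/measurable_EFinP.
- by rewrite fN SN; exact: integrableN int_p.
rewrite fN SN.
transitivity (\int[mu]_(l in S) (-1 * pairing (l : 'cV[R]_n) v)).
  by congr fine; apply: eq_integral => l _; rewrite mulN1r.
by rewrite RintegralZl // mulN1r.
Qed.

End Covectors.

(** * The microscopic Laplacian of e^z *)

Section MicroLaplacian.
Context {R : realType}.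
Notation covectors := (@borel_covectors R 4).

Definition expz (q : 'rV[R]_4) : R := expR (q 0 2).

Definition dirz : 'rV[R]_4 := vec4 0 0 1 0.

Lemma pairing_dirz (l : 'cV[R]_4) : pairing l dirz = l 2 0.
Proof. by rewrite pairingE !vec4E; ring. Qed.

Lemma dirz_Dist q : dirz \in Dist q.
Proof. by rewrite mem_Dist !vec4E !mulr0 subr0. Qed.

Lemma frameXYZ_Dist (i : 'I_3) (q : 'rV[R]_4) : frameXYZ i q \in Dist q.
Proof.
rewrite (basis_mem (frameXYZ_basis q)) //.
by rewrite -(tnth_mktuple (fun i => frameXYZ i q) i) mem_tnth.
Qed.

(** Vertical covectors vanish on the frame; so [h + v] stays in the cosphere, however
large [v] is. *)
Lemma hamiltonian_add_ver (q : 'rV[R]_4) (h v : 'cV[R]_4) : ver (@Dist R) q v ->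
  hamiltonian frameXYZ q (h + v) = hamiltonian frameXYZ q h.
Proof.
move=> vv; congr (_ * _); apply: eq_bigr => i _.
rewrite (_ : pairing (h + v) _ = pairing h (frameXYZ i q)) //.
by rewrite /pairing mulmxDr mxE -/(pairing _ _) -/(pairing _ _) (vv _ (frameXYZ_Dist i q)) addr0.
Qed.

Lemma cosphere_momentum_bound (l : 'cV[R]_4) :
  cosphere_bundle frameXYZ 0 l -> `|l 2 0| <= 1.
Proof.
rewrite /cosphere_bundle /= hamiltonianE !mxE oppr0 expR0 => H.
have: l 2 0 ^+ 2 <= 1 by rewrite -H; nra.
by rewrite ler_norml => h; apply/andP; split; nra.
Qed.

(** The increment of [e^z] is [r t + t^2/4] exactly, with [r] odd on the sphere and
insensitive to the vertical part. *)
Lemma fiber_integral_expz c (muS muV : 'rV[R]_4 -> probability covectors R) (t : R) :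
  uniform_on_sphere frameXYZ c 0 (muS 0) -> muV 0 (ver (@Dist R) 0) = 1%E ->
  0 < t < 1 ->
  fiber_integral (@Dist R) frameXYZ c muS muV 0
    (fun l => expz (exp_map frameXYZ 0 t l) - expz 0) = t ^+ 2 / 4.
Proof.
move=> uS vV t01; rewrite /fiber_integral.
set S : set covectors := hor_sphere frameXYZ c 0; set V : set covectors := ver _ _.
have mS : measurable S by apply: closed_borel_covectors; exact: hor_sphere_closed.
have mV : measurable V by apply: closed_borel_covectors; exact: annihilator_closed.
pose f (l : covectors) : R := pairing (l : 'cV[R]_4) dirz * t + t ^+ 2 / 4.
have cp : measurable_fun setT (fun l : covectors => pairing (l : 'cV[R]_4) dirz).
  by apply: continuous_borel_covectors; exact: continuous_pairing.
have bp : [bounded pairing (l : 'cV[R]_4) dirz | l in S].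
  exists 1; split; first by rewrite num_real.
  move=> M M1 l [/= Hl _]; rewrite pairing_dirz.
  by rewrite (le_trans (cosphere_momentum_bound Hl)) // ltW.
have ip : (muS 0).-integrable S (EFin \o (fun l : covectors => pairing (l : 'cV[R]_4) dirz)).
  apply: measurable_bounded_integrable => //; last exact: measurable_funTS.
  by rewrite (le_lt_trans (probability_le1 _ _)) // ltry.
transitivity (\int[(muS 0%R \x muV 0%R)%E]_(l in S `*` V) f l.1).
  apply: eq_Rintegral => -[h v]; rewrite inE => -[/= [Hh _] Vv].
  rewrite /expz exp_map_expz //; last by rewrite /cosphere_bundle /= hamiltonian_add_ver.
  have v2 : (v : 'cV[R]_4) 2 0 = 0 by rewrite -pairing_dirz; apply: Vv; exact: dirz_Dist.
  by rewrite /f pairing_dirz !mxE v2 expR0; ring.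
rewrite Rintegral_prod_fst //; last 2 first.
- by apply: measurable_funD => //; apply: measurable_funM.
- exists (`|t| + `|t ^+ 2 / 4|); split; first by rewrite num_real.
  move=> M ltM l [/= Hl _]; apply: le_trans (ltW ltM); rewrite (le_trans (ler_normD _ _)) //.
  by rewrite lerD2r normrM pairing_dirz ler_piMl // cosphere_momentum_bound.
rewrite RintegralD //; last 2 first.
- rewrite (_ : _ \o _ = fun l : covectors => (pairing (l : 'cV[R]_4) dirz)%:E * t%:E)%E //.
  exact: integrableZr.
- by apply: finite_measure_integrable_cst.
rewrite RintegralZr // (uniform_odd_integral uS bp) mul0r add0r Rintegral_cst //.
rewrite -[RHS]mulr1; congr (_ * _).
by transitivity (fine (1%E : \bar R)) => //; congr fine; exact: uS.1.
Qed.

Lemma micro_laplacian_expz c (muS muV : 'rV[R]_4 -> probability covectors R) :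
  uniform_on_sphere frameXYZ c 0 (muS 0) -> muV 0 (ver (@Dist R) 0) = 1%E ->
  micro_laplacian (@Dist R) frameXYZ c muS muV expz 0 = 3 / 2.
Proof.
move=> uS vV; apply: cvg_lim => //; apply: cvg_near_cst.
near=> t; rewrite fiber_integral_expz //; last first.
  by apply/andP; split; near: t; [exact: nbhs_right_gt | exact: nbhs_right_lt].
have t0 : 0 < t by near: t; exact: nbhs_right_gt.
by field; rewrite gt_eqF.
Unshelve. all: by end_near. Qed.

End MicroLaplacian.

(** * The macroscopic Laplacian of e^z *)

Section MacroLaplacian.
Context {R : realType}.
Implicit Types q u v : 'rV[R]_4.

Lemma coord_frameXYZ q u i : u \in Dist q ->
  coord (frame_at frameXYZ q) i u = Num.sqrt (gfun q) * u 0 (widen_ord (leqnSn 3) i).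
Proof.
rewrite mem_Dist => /eqP u3; have fr := basis_free (frameXYZ_basis q).
pose a (i : 'I_3) := Num.sqrt (gfun q) * u 0 (widen_ord (leqnSn 3) i).
suff {1}-> : u = \sum_i a i *: (frame_at frameXYZ q)`_i by rewrite coord_sum_free.
have uE i0 : a i0 *: (frame_at frameXYZ q)`_i0 = a i0 *: frameXYZ i0 q.
  by rewrite -tnth_nth tnth_mktuple.
rewrite (eq_bigr _ (fun i _ => uE i)) sum_ord3 !frameXYZE /a /fieldX /fieldY /fieldZ.
have w0 : widen_ord (leqnSn 3) 0 = 0 by exact: val_inj.
have w1 : widen_ord (leqnSn 3) 1 = 1 by exact: val_inj.
have w2 : widen_ord (leqnSn 3) 2 = 2 by exact: val_inj.
rewrite w0 w1 w2; have := sg q; set r := Num.sqrt _ => r0.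
apply/rowP; apply: forall_ord4; rewrite !mxE /=; last first.
  apply: (@mulfI _ 2) => //; rewrite u3.
all: by field.
Qed.

Lemma metricE q u v : u \in Dist q -> v \in Dist q ->
  metric frameXYZ q u v = gfun q * (u 0 0 * v 0 0 + u 0 1 * v 0 1 + u 0 2 * v 0 2).
Proof.
move=> uD vD; rewrite /metric sum_ord3 !coord_frameXYZ //.
have -> : widen_ord (leqnSn 3) 0 = 0 by exact: val_inj.
have -> : widen_ord (leqnSn 3) 1 = 1 by exact: val_inj.
have -> : widen_ord (leqnSn 3) 2 = 2 by exact: val_inj.
by rewrite -[in RHS](@sqr_sqrtr _ (gfun q)) ?expR_ge0 //; ring.
Qed.

Lemma derive_expz q v : is_derive q v (@expz R) (expz q * v 0 2).
Proof. exact: derive_expR (derive_coord _ _ _ _). Qed.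

Lemma smooth_expz : smooth (@expz R).
Proof.
have c0 : continuous (@expz R).
  move=> q; apply: (@continuous_comp _ _ _ (fun q : 'rV[R]_4 => q 0 2)).
    exact: coord_continuous.
  exact: continuous_expR.
have it (s : seq 'I_4) : iter_partial s expz = (fun q => (all (pred1 2) s)%:R * @expz R q).
  elim: s => [|i s IHs]; first by apply/funext => q; rewrite mul1r.
  apply/funext => q; rewrite /= IHs.
  have D := derive_mul (derive_const q (delta_mx 0 i) (all (pred1 2) s)%:R)
     (derive_expz q (delta_mx 0 i)).
  rewrite (@derive_val _ _ _ _ _ _ _ D) /= !mxE eqxx mulr0 addr0 eq_sym.
  by case: (i == 2); rewrite /= ?mulr1 ?mulr0 ?mul0r.
move=> s; rewrite it; split=> [|q i].
  by apply: continuous_mul => //; exact: cst_continuous.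
by have [] := derive_mul (derive_const q (delta_mx 0 i) (all (pred1 2) s)%:R)
     (derive_expz q (delta_mx 0 i)).
Qed.

(** [Z e^z = e^z / sqrt g] and [Z = (1 / sqrt g) d/dz], so the powers of [g = e^z]
cancel and the gradient is a constant field. *)
Lemma gradient_expz q : gradient (@Dist R) frameXYZ expz q = dirz.
Proof.
have zD := @dirz_Dist R q.
have dzE : forall v, v \in Dist q -> metric frameXYZ q dirz v = 'D_v expz q.
  move=> v vD; rewrite (@derive_val _ _ _ _ _ _ _ (derive_expz q v)) metricE // !vec4E.
  by rewrite /gfun /zc /expz; ring.
rewrite /gradient; case: xgetP => [u _ [uD uE]|/(_ dirz)[]//].
have uzD : u - dirz \in Dist q by rewrite memvB.
have : metric frameXYZ q u (u - dirz) = metric frameXYZ q dirz (u - dirz).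
  by rewrite uE // dzE.
have g0 : gfun q != 0 by rewrite gt_eqF ?expR_gt0.
rewrite !metricE // => /(mulfI g0); rewrite !mxE /= => /eqP.
rewrite -subr_eq0 => /eqP E.
have {E}: u 0 0 ^+ 2 + u 0 1 ^+ 2 + (u 0 2 - 1) ^+ 2 = 0 by rewrite -[RHS]E /=; ring.
move=> /eqP; rewrite paddr_eq0 ?addr_ge0 ?sqr_ge0 // paddr_eq0 ?sqr_ge0 // !sqrf_eq0 subr_eq0.
move=> /andP[/andP[/eqP u0 /eqP u1] /eqP u2].
move: uD; rewrite mem_Dist u0 u1 !mulr0 subr0 mulf_eq0 pnatr_eq0 /= => /eqP u3.
by apply/rowP; apply: forall_ord4; rewrite !mxE.
Qed.

Lemma popp_densityE q : popp_density q = expR (5 / 2 * q 0 2) / Num.sqrt 2.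
Proof. by rewrite /popp_density /powR gt_eqF ?expR_gt0 // expRK. Qed.

(** A constant field preserves the coordinate volume, so only the density is
differentiated. *)
Lemma divergence_const n (rho : 'rV[R]_n -> R) (q e : 'rV[R]_n) (a : R) :
  rho q != 0 -> is_derive q e rho (a * rho q) ->
  divergence (volume_form rho) (fun=> e) q = a.
Proof.
move=> r0 drho.
have lieE w : lie_derivative (fun=> e) (volume_form rho) q w = a * volume_form rho q w.
  rewrite /lie_derivative big1 => [|i _]; last first.
    rewrite derive_cst /volume_form (expand_det_row _ i) big1 ?mulr0 // => j _.
    by rewrite !mxE eqxx mxE mul0r.
  rewrite addr0 /volume_form.
  have D := derive_mul drho (derive_const q e (\det (\matrix_i w i))).
  by rewrite (@derive_val _ _ _ _ _ _ _ D) /=; ring.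
rewrite /divergence; case: xgetP => [d _ /= H|/(_ a)[]//].
(* a nondegenerate tuple of vectors determines the coefficient *)
have := H (fun i => delta_mx 0 i); rewrite lieE /volume_form.
rewrite (_ : \matrix_i _ = 1%:M); last by apply/matrixP => i j; rewrite !mxE eqxx eq_sym.
by rewrite det1 mulr1 => /(mulIf r0).
Qed.

Lemma macro_laplacian_expz q :
  macro_laplacian (@Dist R) frameXYZ (volume_form (@popp_density R)) expz q = 5 / 2.
Proof.
rewrite /macro_laplacian (funext gradient_expz).
apply: divergence_const.
  by rewrite popp_densityE mulf_neq0 ?gt_eqF ?expR_gt0 // invr_gt0 sqrtr_gt0.
rewrite (funext popp_densityE).
apply: is_derive_eq (derive_mul
   (derive_expR (derive_mul (derive_const q dirz (5 / 2)) (derive_coord _ _ _ _)))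
   (derive_const _ _ _)) _.
by rewrite /= !vec4E; ring.
Qed.

End MacroLaplacian.

(** * Popp's volume *)

Section PoppVolume.
Context {R : realType}.
Implicit Types q u v : 'rV[R]_4.

(** A multiple of the pairing with [eta] that avoids the conformal factor and the
square root: [eta = g / (2 sqrt 2) * contact]. *)
Definition contact q u : R := 2 * u 0 3 - yc q * u 0 0 + xc q * u 0 1.

Lemma contactB q u v : contact q (u - v) = contact q u - contact q v.
Proof. by rewrite /contact !mxE; ring. Qed.

Lemma contactD q u v : contact q (u + v) = contact q u + contact q v.
Proof. by rewrite /contact !mxE; ring. Qed.

Lemma contactZ q a u : contact q (a *: u) = a * contact q u.
Proof. by rewrite /contact !mxE; ring. Qed.

Lemma mem_Dist_contact q u : (u \in Dist q) = (contact q u == 0).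
Proof. by rewrite mem_Dist -subr_eq0; congr (_ == 0); rewrite /contact; ring. Qed.

Lemma sqrt_gfun q : Num.sqrt (gfun q) = expR (q 0 2 / 2).
Proof.
by rewrite /gfun /zc [in LHS](splitr (q 0 2)) expRD -expr2 sqrtr_sqr ger0_norm ?expR_ge0.
Qed.

Lemma gfun_sqrt q : gfun q = Num.sqrt (gfun q) ^+ 2.
Proof. by rewrite sqr_sqrtr ?expR_ge0. Qed.

(** The derivative of the conformal factor contributes a multiple of the field itself,
which [contact] kills; only the derivative of the coefficient of d/dw remains. *)
Lemma contact_derive_frame q v :
  let r := (Num.sqrt (gfun q))^-1 in
  [/\ contact q ('D_v (@fieldX R) q) = r * v 0 1,
      contact q ('D_v (@fieldY R) q) = - (r * v 0 0)
    & contact q ('D_v (@fieldZ R) q) = 0].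
Proof.
move=> r.
have dr : is_derive q v (fun y : 'rV[R]_4 => (Num.sqrt (gfun y))^-1) (- (r * v 0 2 / 2)).
  have rE (y : 'rV[R]_4) : (Num.sqrt (gfun y))^-1 = expR (- (y 0 2 / 2)).
    by rewrite sqrt_gfun expRN.
  rewrite /r rE (funext rE); apply: is_derive_eq (derive_expR (derive_opp
    (derive_mul (derive_coord q v 0 2) (derive_const _ _ 2^-1)))) _.
  by rewrite /=; field.
have dfield (h : 'I_4 -> 'rV[R]_4 -> R) (dh : 'I_4 -> R) :
    (forall i, is_derive q v (h i) (dh i)) ->
    contact q ('D_v (fun y => (Num.sqrt (gfun y))^-1 *: (\row_i h i y)) q) =
    r * (2 * dh 3 - yc q * dh 0 + xc q * dh 1) - r * v 0 2 / 2 * contact q (\row_i h i q).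
  move=> Dh; have D : is_derive q v (fun y => (Num.sqrt (gfun y))^-1 *: (\row_i h i y))
      (\row_i (r * dh i - h i q * (r * v 0 2 / 2))).
    apply/is_derive_mx => i j; rewrite ord1 mxE.
    rewrite (_ : (fun y => _) = (fun y : 'rV[R]_4 => (Num.sqrt (gfun y))^-1 * h j y)); last first.
      by apply/funext => y; rewrite !mxE.
    by apply: is_derive_eq (derive_mul dr (Dh j)) _; rewrite /= -/r; ring.
  by rewrite (@derive_val _ _ _ _ _ _ _ D) /contact !mxE; ring.
split.
- transitivity (r * (2 * (2^-1 * v 0 1) - yc q * 0 + xc q * 0) -
    r * v 0 2 / 2 * contact q (vec4 1 0 0 (2^-1 * yc q))); last first.
    by rewrite /contact !vec4E; field.
  apply: (dfield (fun i y => [:: 1; 0; 0; 2^-1 * yc y]`_i)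
    (fun i => [:: 0; 0; 0; 2^-1 * v 0 1]`_i)).
  apply: forall_ord4; do ?exact: derive_const.
  apply: is_derive_eq (derive_mul (derive_const _ _ 2^-1) (derive_coord q v 0 1)) _.
  by rewrite /= mulr0 addr0.
- transitivity (r * (2 * (- (2^-1 * v 0 0)) - yc q * 0 + xc q * 0) -
    r * v 0 2 / 2 * contact q (vec4 0 1 0 (- (2^-1 * xc q)))); last first.
    by rewrite /contact !vec4E; field.
  apply: (dfield (fun i y => [:: 0; 1; 0; - (2^-1 * xc y)]`_i)
    (fun i => [:: 0; 0; 0; - (2^-1 * v 0 0)]`_i)).
  apply: forall_ord4; do ?exact: derive_const.
  apply: is_derive_eq (derive_opp (derive_mul (derive_const _ _ 2^-1) (derive_coord q v 0 0))) _.
  by rewrite /= mulr0 addr0.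
transitivity (r * (2 * 0 - yc q * 0 + xc q * 0) -
    r * v 0 2 / 2 * contact q (vec4 0 0 1 0)); last first.
  by rewrite /contact !vec4E; field.
apply: (dfield (fun i y => [:: 0; 0; 1; 0]`_i) (fun i => [:: 0; 0; 0; 0]`_i)).
by apply: forall_ord4; exact: derive_const.
Qed.

Lemma contact_derive_frameXYZ i q v : contact q ('D_v (frameXYZ i) q) =
  (Num.sqrt (gfun q))^-1 * ((i == 0)%:R * v 0 1 - (i == 1)%:R * v 0 0).
Proof.
have [X Y Z] := contact_derive_frame q v.
case: i => [[|[|[|//]]] i]; rewrite /frameXYZ (tnth_nth (@fieldX R)) /=.
- by rewrite X; ring.
- by rewrite Y; ring.
- by rewrite Z; ring.
Qed.

Lemma frameXYZ01 (i : 'I_3) q :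
  (frameXYZ i q 0 0 = (Num.sqrt (gfun q))^-1 * (i == 0)%:R) *
  (frameXYZ i q 0 1 = (Num.sqrt (gfun q))^-1 * (i == 1)%:R).
Proof.
by case: i => [[|[|[|//]]] i]; rewrite /frameXYZ (tnth_nth (@fieldX R)) /= !mxE.
Qed.

Lemma contact_bracket (i j : 'I_3) q :
  contact q (lie_bracket (frameXYZ i) (frameXYZ j) q) =
  2 / gfun q * ((i == 1)%:R * (j == 0)%:R - (i == 0)%:R * (j == 1)%:R).
Proof.
rewrite contactB !contact_derive_frameXYZ !frameXYZ01.
rewrite [X in _ = 2 / X * _]gfun_sqrt; have := sg q; set r := Num.sqrt _ => r0.
by field.
Qed.

Lemma contact_bracket_map q (e : 'M[R]_3) :
  contact q (bracket_map frameXYZ q e) = 2 / gfun q * (e 1 0 - e 0 1).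
Proof.
have sE (B : 'I_3 -> 'I_3 -> 'rV[R]_4) : contact q (\sum_i \sum_j e i j *: B i j) =
    \sum_i \sum_j e i j * contact q (B i j).
  by rewrite !sum_ord3 !contactD !contactZ.
rewrite /bracket_map sE (eq_bigr (fun i => \sum_j e i j * (2 / gfun q *
  ((i == 1)%:R * (j == 0)%:R - (i == 0)%:R * (j == 1)%:R)))) => [|i _]; last first.
  by apply: eq_bigr => j _; rewrite contact_bracket.
by rewrite !sum_ord3 /=; ring.
Qed.

Lemma bracket_map_mod_Dist q (e : 'M[R]_3) u :
  (bracket_map frameXYZ q e - u \in Dist q) = (e 1 0 - e 0 1 == gfun q / 2 * contact q u).
Proof.
have g0 : gfun q != 0 by rewrite gt_eqF ?expR_gt0.
rewrite mem_Dist_contact contactB contact_bracket_map subr_eq0.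
apply/eqP/eqP => [<-|->]; by field.
Qed.

Lemma bracket_generating_frameXYZ : bracket_generating2 (@Dist R) frameXYZ.
Proof.
move=> q u; exists (gfun q / 2 * contact q u *: delta_mx 1 0).
by rewrite bracket_map_mod_Dist !mxE /= mulr1 mulr0 subr0.
Qed.

(** Only the antisymmetric part in the [X], [Y] plane is seen by the bracket map, and
the norm is minimal when the required difference is split equally between
[e 1 0] and [- e 0 1]. *)
Lemma quotient_norm_sqr q u :
  quotient_norm (@Dist R) frameXYZ q u ^+ 2 = (gfun q * contact q u) ^+ 2 / 8.
Proof.
set s := gfun q / 2 * contact q u.
have sE : (gfun q * contact q u) ^+ 2 / 8 = s ^+ 2 / 2 by rewrite /s; field.
pose e0 : 'M[R]_3 := (s / 2) *: (delta_mx 1 0 - delta_mx 0 1).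
have tnE (e : 'M[R]_3) : \sum_i \sum_j e i j ^+ 2 =
    e 0 0 ^+ 2 + e 0 1 ^+ 2 + e 0 2 ^+ 2 + (e 1 0 ^+ 2 + e 1 1 ^+ 2 + e 1 2 ^+ 2) +
    (e 2 0 ^+ 2 + e 2 1 ^+ 2 + e 2 2 ^+ 2) by rewrite !sum_ord3.
have tn0 : tensor_norm e0 = Num.sqrt (s ^+ 2 / 2).
  by rewrite /tensor_norm tnE !mxE /=; congr Num.sqrt; field.
suff -> : quotient_norm (@Dist R) frameXYZ q u = Num.sqrt (s ^+ 2 / 2).
  by rewrite sqr_sqrtr ?sE // divr_ge0 ?sqr_ge0.
apply/eqP; rewrite eq_le; apply/andP; split.
  rewrite -tn0; apply: ge_inf; first by exists 0 => _ [e _ <-]; exact: sqrtr_ge0.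
  exists e0 => //=; rewrite bracket_map_mod_Dist !mxE /= -/s; apply/eqP; by field.
apply: lb_le_inf; first by exists (tensor_norm e0), e0 => //=;
  rewrite bracket_map_mod_Dist !mxE /= -/s; apply/eqP; field.
move=> _ [e /= + <-]; rewrite bracket_map_mod_Dist -/s => /eqP es.
rewrite ler_wsqrtr // tnE -es -subr_ge0.
rewrite (_ : _ - _ = (e 1 0 + e 0 1) ^+ 2 / 2 + (e 0 0 ^+ 2 + e 0 2 ^+ 2 + e 1 1 ^+ 2 +
  e 1 2 ^+ 2 + e 2 0 ^+ 2 + e 2 1 ^+ 2 + e 2 2 ^+ 2)); last by field.
by rewrite !(addr_ge0, divr_ge0, sqr_ge0).
Qed.

(** The columns are [sqrt g dx], [sqrt g dy], [sqrt g dz] and [eta]: the first three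
restrict to the dual frame of [X], [Y], [Z], so that multiplication by this matrix
turns an adapted basis into a block-triangular matrix with orthogonal blocks. *)
Definition coframe q : 'M[R]_4 :=
  let r := Num.sqrt (gfun q) in
  \matrix_(i, j) (r *: vec4 (i == 0)%:R (i == 1)%:R (i == 2)%:R 0 +
     (r ^+ 2 / (2 * Num.sqrt 2)) *: vec4 0 0 0 (contact q (delta_mx 0 i))) 0 j.

Lemma sqrt2_neq0 : Num.sqrt 2 != 0 :> R.
Proof. by rewrite gt_eqF // sqrtr_gt0. Qed.

Lemma popp_density_sqrt q : popp_density q = Num.sqrt (gfun q) ^+ 5 / Num.sqrt 2.
Proof.
rewrite popp_densityE sqrt_gfun -expRM_natl; congr (expR _ / _).
by rewrite -mulr_natl; field.
Qed.

Lemma det_coframe q : \det (coframe q) = popp_density q.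
Proof.
rewrite -det_tr det_trig; last first.
  apply/is_trig_mxP => i j; rewrite !mxE.
  by case: i => [[|[|[|[|//]]]] ?]; case: j => [[|[|[|[|//]]]] ?] //= _; rewrite ?mulr0 ?addr0.
rewrite !big_ord_recl big_ord0 !mxE /contact !mxE /= popp_density_sqrt.
have := sqrt2_neq0; set r := Num.sqrt (gfun q); set s := Num.sqrt 2 => s0.
by field.
Qed.

Lemma mul_coframe q n (w : 'I_n -> 'rV[R]_4) (i : 'I_n) (j : 'I_4) :
  ((\matrix_i w i) *m coframe q) i j =
  let r := Num.sqrt (gfun q) in
  if j == 3 then r ^+ 2 / (2 * Num.sqrt 2) * contact q (w i) else r * w i 0 j.
Proof.
rewrite mxE sum_ord4 !mxE /contact !mxE.
by move: j; apply: forall_ord4; rewrite /=; have := sqrt2_neq0; set s := Num.sqrt 2 => s0; field.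
Qed.

Lemma popp_volumeXYZ : is_popp_volume (@Dist R) frameXYZ (@popp_density R).
Proof.
split=> [|q]; first exact: bracket_generating_frameXYZ.
split=> [|w [wD wO wN]].
  by rewrite popp_densityE divr_gt0 ?expR_gt0 // sqrtr_gt0.
have [N NE ->] : exists2 N : 'M[R]_(3 + 1),
    (forall i j, N i j = if j == 3 then
       Num.sqrt (gfun q) ^+ 2 / (2 * Num.sqrt 2) * contact q (w i)
       else Num.sqrt (gfun q) * w i 0 j)
    & volume_form popp_density q w = \det N.
  exists ((\matrix_i w i) *m coframe q) => [i j|]; first exact: mul_coframe.
  by rewrite /volume_form -det_coframe mulrC -det_mulmx.
(* the first three vectors are horizontal, so [eta] kills them *)
have N0 : ursubmx N = 0.
  apply/matrixP => i j; rewrite !mxE NE ord1.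
  have -> : rshift 3 0 = 3 :> 'I_(3 + 1) by exact: val_inj.
  rewrite eqxx (eqP (_ : contact q _ == 0)) ?mulr0 //.
  by rewrite -mem_Dist_contact wD //= ltn_ord.
have NO : ulsubmx N *m (ulsubmx N)^T = 1%:M.
  apply/matrixP => i j; rewrite !mxE.
  have := wO (lshift 1 i) (lshift 1 j) (ltn_ord i) (ltn_ord j).
  rewrite (metricE (wD (lshift 1 i) (ltn_ord i)) (wD (lshift 1 j) (ltn_ord j))).
  rewrite (_ : (_ == _) = (i == j)) => [<-|]; last exact: (inj_eq (@lshift_inj 3 1)).
  rewrite sum_ord3 gfun_sqrt !mxE !NE.
  have -> : lshift 1 0 = 0 :> 'I_(3 + 1) by exact: val_inj.
  have -> : lshift 1 1 = 1 :> 'I_(3 + 1) by exact: val_inj.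
  have -> : lshift 1 2 = 2 :> 'I_(3 + 1) by exact: val_inj.
  by rewrite /=; ring.
have detO : (\det (ulsubmx N)) ^+ 2 = 1.
  by rewrite expr2 -{2}det_tr -det_mulmx NO det1.
(* the class of the last vector is a unit vector of the quotient *)
have detv : (\det (drsubmx N)) ^+ 2 = 1.
  rewrite det_mx11 !mxE NE.
  have -> : rshift 3 0 = 3 :> 'I_(3 + 1) by exact: val_inj.
  rewrite eqxx; have := wN (fun=> 1).
  rewrite !(big_pred1 (3 : 'I_4)) => [|l|l]; last 2 first.
  - by case: l => [[|[|[|[|//]]]] ?].
  - by case: l => [[|[|[|[|//]]]] ?].
  rewrite scale1r quotient_norm_sqr expr1n => w3; rewrite -[RHS]w3 [in RHS]gfun_sqrt.
  have s2 : (8 : R) = 4 * Num.sqrt 2 ^+ 2 by rewrite sqr_sqrtr //; ring.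
  by rewrite s2; have := sqrt2_neq0; set s := Num.sqrt 2 => s0; field.
rewrite -[N]submxK N0 det_lblock; apply/eqP.
by rewrite -(@eqrXn2 _ 2) // real_normK ?num_real // exprMn detO detv expr1n mul1r.
Qed.

End PoppVolume.

(** * The two Laplacians differ *)

Theorem proposition13 (R : realType) :
  is_popp_volume (@Dist R) (@frameXYZ R) (@popp_density R) /\
  forall (c : 'rV[R]_4 -> {vspace 'rV[R]_4})
         (muS muV : 'rV[R]_4 -> probability (@borel_covectors R 4) R),
    is_complement 1 (@Dist R) c ->
    admissible_measures (@Dist R) (@frameXYZ R) c muS muV ->
    ~ (forall f : 'rV[R]_4 -> R, smooth f ->
       forall q : 'rV[R]_4,
         micro_laplacian (@Dist R) (@frameXYZ R) c muS muV f q =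
         macro_laplacian (@Dist R) (@frameXYZ R) (volume_form (@popp_density R)) f q).
Proof.
split; first exact: popp_volumeXYZ.
move=> c muS muV _ [uS vV _ _] /(_ _ (@smooth_expz R) 0).
rewrite micro_laplacian_expz // macro_laplacian_expz.
by move=> h; lra.
Qed.
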